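(* Consider the two-period model $$Y_t=h_t(\alpha+X_t\beta-U_t),\qquad t=1,2,$$ where $\alpha$ is a real random variable, $X_t$ is a random $1\times K$ row vector, $\beta\in\mathbb{R}^K$, $X=(X_1,X_2)$, $Y=(Y_1,Y_2)$, and $F_t(u\mid\alpha,X)$ denotes the conditional CDF of $U_t$ given $(\alpha,X)$. Suppose the joint distribution of $(Y,X)$ is observed and that: (A1) for each $t$, $h_t:\mathbb{R}\to\mathcal{Y}$ is unknown, non-decreasing, right continuous and non-constant; (Logit) (i) $F_1(u\mid\alpha,X)=F_2(u\mid\alpha,X)=\Lambda(u)=\dfrac{\exp(u)}{1+\exp(u)}$, and $U_1$ and $U_2$ are independent conditionally on $(\alpha,X)$; (ii) with $\Delta X=X_2-X_1$ and $W=(\Delta X,-1)$, the matrix $E(W'W)$ is invertible. Then, for an arbitrary pair $(y_1,y_2)\in\underline{\mathcal{Y}}^2$, $\theta(y_1,y_2)=(\beta,\gamma(y_1,y_2))$, where $\gamma(y_1,y_2)=h_2^-(y_2)-h_1^-(y_1)$, is identified. If additionally, for some (given) $y_0\in\underline{\mathcal{Y}}$, $h_1^-(y_0)=0$, then the transformations $h_1$ and $h_2$ are identified.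
   Context: The set $\mathcal{Y}\subseteq\mathbb{R}$ is the (known) support of $Y_t$, understood as the set of values $h_t(\mathbb{R})$, the same for $t=1,2$; the support of the latent variable $\alpha+X_t\beta-U_t$ is $\mathbb{R}$. Set $\underline{\mathcal{Y}}=\mathcal{Y}\setminus\{\inf\mathcal{Y}\}$. The generalized inverse of $h_t$ is $h_t^-(y)=\inf\{y^*\in\mathbb{R}: y\le h_t(y^* )\}$, $y\in\mathcal{Y}$ (with the convention $\inf\emptyset=\inf\mathcal{Y}$). $(\alpha,U_1,U_2)$ are unobserved; no restriction is placed on the joint distribution of $(\alpha,X)$ other than those stated. A structure consists of $(\beta,h_1,h_2)$ together with a joint distribution of $(\alpha,X,U_1,U_2)$. A functional of the structure is ''identified'' if any two structures that both satisfy the model and all the stated assumptions (with the same $y_0$ where relevant) and that generate the same joint distribution of $(Y,X)$ give the same value of that functional. *)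

(* Defs.v *)
From HB Require Import structures.
From mathcomp Require Import all_boot all_order all_algebra.
From mathcomp Require Import all_classical all_reals all_analysis.

Set Implicit Arguments.
Unset Strict Implicit.
Unset Printing Implicit Defensive.

Import Order.TTheory GRing.Theory Num.Theory.
Import numFieldNormedType.Exports.

Local Open Scope classical_set_scope.
Local Open Scope ring_scope.

Section conditioning.
Context d d' (T : measurableType d) (V : measurableType d') (R : realType).
Variable P : probability T R.

(* g \o Z is a version of the conditional probability P(A | Z). *)
Definition is_cond_prob (Z : T -> V) (A : set T) (g : V -> R) : Prop :=
  [/\ measurable_fun [set: V] g,
      P.-integrable [set: T] (EFin \o (g \o Z)) &
      forall B : set V, measurable B ->
        P (A `&` Z @^-1` B) = (\int[P]_(w in Z @^-1` B) (g (Z w))%:E)%E].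

Definition is_cond_cdf (U : T -> R) (Z : T -> V) (F : R -> V -> R) : Prop :=
  forall u : R, is_cond_prob Z [set w | U w <= u] (F u).

(* Versions of a conditional probability agree almost surely and always exist,
   so quantifying over all of them is the same as fixing one. *)
Definition cond_independent (U1 U2 : T -> R) (Z : T -> V) : Prop :=
  forall (A1 A2 : set R) (g1 g2 : V -> R),
    measurable A1 -> measurable A2 ->
    is_cond_prob Z (U1 @^-1` A1) g1 -> is_cond_prob Z (U2 @^-1` A2) g2 ->
    is_cond_prob Z (U1 @^-1` A1 `&` U2 @^-1` A2) (fun v => g1 v * g2 v).

Definition has_full_support (L : T -> R) : Prop :=
  forall O : set R, open O -> O !=set0 -> (0 < P (L @^-1` O))%E.

(* The entries are required to be integrable, so that the expectation is a
   genuine real matrix and [fine] discards nothing. *)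
Definition expectation_invertible n (M : T -> 'M[R]_n) : Prop :=
  (forall i j, P.-integrable [set: T] (fun w => (M w i j)%:E)) /\
  (\matrix_(i, j) fine ('E_P[fun w => M w i j])%E) \in unitmx.

End conditioning.

Section model.
Context (R : realType) (K : nat).

Definition Lambda (u : R) : R := expR u / (1 + expR u).

(* Covariates (x_1, x_2) are tuples, for which the library has the product
   sigma-algebra; [rowX] turns them into row vectors.  A point of the sample
   space is ((alpha, (x_1, x_2)), (u_1, u_2)). *)
Local Notation covariates := (K.-tuple R * K.-tuple R)%type.
Local Notation sample := ((R * covariates) * (R * R))%type.

Definition rowX (x : K.-tuple R) : 'rV[R]_K := \row_j tnth x j.

Definition alpha (w : sample) : R := w.1.1.
Definition X (w : sample) : covariates := w.1.2.
Definition X1 (w : sample) : 'rV[R]_K := rowX (X w).1.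
Definition X2 (w : sample) : 'rV[R]_K := rowX (X w).2.
Definition U1 (w : sample) : R := w.2.1.
Definition U2 (w : sample) : R := w.2.2.
Definition alphaX (w : sample) : R * covariates := (alpha w, X w).

Definition W (w : sample) : 'rV[R]_(K + 1) :=
  row_mx (X2 w - X1 w) (const_mx (- 1)).

Record structure := Structure {
  beta : 'cV[R]_K ;
  h1 : R -> R ;
  h2 : R -> R ;
  law : probability sample R }.

Definition latent1 (s : structure) (w : sample) : R :=
  alpha w + (X1 w *m beta s) 0 0 - U1 w.
Definition latent2 (s : structure) (w : sample) : R :=
  alpha w + (X2 w *m beta s) 0 0 - U2 w.

Definition Y1 (s : structure) (w : sample) : R := h1 s (latent1 s w).
Definition Y2 (s : structure) (w : sample) : R := h2 s (latent2 s w).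

Definition YX (s : structure) (w : sample) : (R * R) * covariates :=
  ((Y1 s w, Y2 s w), X w).

Definition same_observables (s s' : structure) : Prop :=
  forall B : set ((R * R) * covariates), measurable B ->
    pushforward (law s) (YX s) B = pushforward (law s') (YX s') B.

(* [M] is the set of structures satisfying the model and its assumptions. *)
Definition identified (A : Type) (M : set structure) (f : structure -> A) :
    Prop :=
  forall s s' : structure, M s -> M s' -> same_observables s s' -> f s = f s'.

Section support.
Variable Ysupp : set R.

Definition inf_supp : \bar R := ereal_inf (EFin @` Ysupp).

Definition Yunder : set R := [set y | Ysupp y /\ y%:E != inf_supp].

(* The inverse is extended-real valued because it equals -oo at a minimum of
   the support; it is finite on [Yunder]. *)
Definition ginv (h : R -> R) (y : R) : \bar R :=
  let S := [set x : R | y <= h x] in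
  if S == set0 then inf_supp else ereal_inf (EFin @` S).

Definition transformation (h : R -> R) : Prop :=
  [/\ range h = Ysupp,
      {homo h : x y / x <= y},
      (forall x, h y @[y --> x^'+] --> h x) &
      (exists x y, h x <> h y)].

Definition logit (s : structure) : Prop :=
  [/\ is_cond_cdf (law s) U1 alphaX (fun u _ => Lambda u),
      is_cond_cdf (law s) U2 alphaX (fun u _ => Lambda u),
      cond_independent (law s) U1 U2 alphaX &
      expectation_invertible (law s) (fun w => (W w)^T *m W w)].

Definition admissible : set structure :=
  [set s | [/\ transformation (h1 s), transformation (h2 s),
               has_full_support (law s) (latent1 s),
               has_full_support (law s) (latent2 s) & logit s]].

Definition gamma (y1 y2 : R) (s : structure) : \bar R :=
  (ginv (h2 s) y2 - ginv (h1 s) y1)%E.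

Definition theta (y1 y2 : R) (s : structure) : 'cV[R]_K * \bar R :=
  (beta s, gamma y1 y2 s).

Definition normalized (y0 : R) : set structure :=
  [set s | ginv (h1 s) y0 = 0%E].

End support.
End model.

(* Main.v *)
(** By right continuity and monotonicity, [y <= h_t x] iff [c_t <= x], where
    [c_t := h_t^-(y)] is finite because [y] is not the infimum of the support.
    So [D_t := 1{Y_t >= y_t}] is [1{U_t <= alpha + X_t beta - c_t}], and since
    the conditional law of [(U_1, U_2)] given [(alpha, X)] does not depend on
    [(alpha, X)], the probabilities of [(D_1, D_2) = (0, 1)] and [(1, 0)] given
    [(alpha, X)] are products of logistic probabilities at random thresholds.
    Their ratio is [exp (DeltaX beta - gamma)], in which [alpha] cancels
    (Rasch's conditional logit).  The observed measures
    [B |-> P (D = (0, 1), X in B)] and [B |-> P (D = (1, 0), X in B)] therefore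
    determine [DeltaX beta - gamma = W theta] almost surely; hence two
    observationally equivalent parameters satisfy
    [E(W'W) (theta - theta') = 0].  Under the normalization, the differences
    [gamma] give both generalized inverses on all of [Yunder], and these
    determine [h_1] and [h_2]. *)

Require Import Defs.
From HB Require Import structures.
From mathcomp Require Import all_boot all_order all_algebra.
From mathcomp Require Import all_classical all_reals all_analysis.
From mathcomp Require Import measurable_realfun ring.

Set Implicit Arguments.
Unset Strict Implicit.
Unset Printing Implicit Defensive.
Import Order.TTheory GRing.Theory Num.Theory.
Import numFieldNormedType.Exports.

Local Open Scope classical_set_scope.
Local Open Scope ring_scope.

(** * Uniqueness of finite measures *)

(** Closed left rays are stable under intersection and generate the Borel sets, and the rays up to
    [n] exhaust the line, so the pi-lambda theorem applies. *)
Lemma finite_measure_eq_on_rays (R : realType)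
    (m1 m2 : {measure set R -> \bar R}) :
  (m1 setT < +oo)%E ->
  (forall u, m1 `]-oo, u]%classic = m2 `]-oo, u]%classic) ->
  forall A, measurable A -> m1 A = m2 A.
Proof.
move=> m1fin m12; pose G := range (fun u : R => `]-oo, u]%classic).
apply: (measure_unique G (fun n => `]-oo, n%:R]%classic)).
- rewrite eqEsubset; split => A; last first.
    apply: smallest_sub; first exact: sigma_algebra_measurable.
    by move=> _ [u _ <-]; exact: measurable_itv.
  rewrite /measurable/= /measurableR RGenOInfty.measurableE.
  apply: smallest_sub; first exact: smallest_sigma_algebra.
  move=> _ [u ->]; rewrite -setCitvl.
  apply: (@measurableC _ (g_sigma_algebraType G)).
  by apply: sub_sigma_algebra; exists u.
- move=> _ _ [u _ <-] [v _ <-]; exists (Num.min u v) => //.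
  by apply/seteqP; split => x /=; rewrite !in_itv/= le_min => /andP.
- by move=> n; exists n%:R.
- rewrite -subTset => x _; exists (Num.truncn x).+1 => //=.
  by rewrite in_itv/= ltW// truncnS_gt.
- by move=> _ [u _ <-].
- move=> n; apply: le_lt_trans m1fin.
  by apply: le_measure => //; rewrite inE.
Qed.

Lemma finite_measure_eq_on_rectangles d1 d2 (T1 : measurableType d1)
    (T2 : measurableType d2) (R : realType)
    (m1 m2 : {measure set (T1 * T2) -> \bar R}) :
  (m1 setT < +oo)%E ->
  (forall A B, measurable A -> measurable B -> m1 (A `*` B) = m2 (A `*` B)) ->
  forall E, measurable E -> m1 E = m2 E.
Proof.
move=> m1fin m12.
apply: (measure_unique [set A `*` B | A in measurable & B in measurable]
  (fun=> setT)).
- exact: measurable_prod_measurableType.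
- move=> _ _ [A mA [B mB <-]] [A' mA' [B' mB' <-]].
  exists (A `&` A'); first exact: measurableI.
  by exists (B `&` B'); [exact: measurableI|rewrite setXI].
- by move=> _; exists setT => //; exists setT => //; rewrite setXTT.
- by rewrite bigcup_const.
- by move=> _ [A mA [B mB <-]]; exact: m12.
- by [].
Qed.

(** Packages an image measure as a bundled measure, the form to which the uniqueness lemmas
    apply. *)
Lemma pushforward_measure_exists d d' (T : measurableType d)
    (T' : measurableType d') (R : realType) (m : {measure set T -> \bar R})
    (f : T -> T') : measurable_fun setT f ->
  exists m' : {measure set T' -> \bar R}, forall A, m' A = m (f @^-1` A).
Proof.
move=> mf.
by exists
  (measure_function_pushforward__canonical__measure_function_Measure m mf).
Qed.

(** * Independence from a constant conditional CDF *)

Section independence.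
Context d d' (T : measurableType d) (V : measurableType d') (R : realType).
Variables (P : probability T R) (Z : T -> V).
Hypothesis mZ : measurable_fun setT Z.

Lemma integral_preimage_cst (B : set V) (p : R) : measurable B ->
  (\int[P]_(w in Z @^-1` B) (cst p (Z w))%:E = p%:E * P (Z @^-1` B))%E.
Proof.
move=> mB; rewrite -integral_cst//.
by rewrite -[_ @^-1` _]setTI; exact: mZ.
Qed.

Lemma cond_prob_cstE (A : set T) (p : R) : is_cond_prob P Z A (cst p) ->
  forall B, measurable B -> P (A `&` Z @^-1` B) = (p%:E * P (Z @^-1` B))%E.
Proof. by move=> [_ _ cA] B mB; rewrite cA// integral_preimage_cst. Qed.

Lemma cond_prob_cst (A : set T) (p : R) :
  (forall B, measurable B -> P (A `&` Z @^-1` B) = (p%:E * P (Z @^-1` B))%E) ->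
  is_cond_prob P Z A (cst p).
Proof.
move=> cA; split; first exact: measurable_cst.
- exact: (@finite_measure_integrable_cst _ _ _ P setT p).
- by move=> B mB; rewrite cA// integral_preimage_cst.
Qed.

Variable U : {mfun T >-> R}.
Variable F : R -> R.
Hypothesis cU : is_cond_cdf P U Z (fun u _ => F u).

Lemma cond_cdf_cst_ray u : distribution P U `]-oo, u]%classic = (F u)%:E.
Proof.
have := cond_prob_cstE (cU u) measurableT.
by rewrite preimage_setT setIT probability_setT mule1.
Qed.

Lemma cond_cdf_cst_coray u :
  distribution P U `]u, +oo[%classic = (1 - F u)%:E.
Proof. by rewrite -setCitvl probability_setC// EFinB -cond_cdf_cst_ray. Qed.

(** For fixed [B] both sides are finite measures in [A]; the constant conditional CDF makes them
    agree on rays, hence everywhere. *)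
Lemma cond_cdf_cst_indep (A : set R) (B : set V) :
  measurable A -> measurable B ->
  P (U @^-1` A `&` Z @^-1` B) = (P (U @^-1` A) * P (Z @^-1` B))%E.
Proof.
move=> mA mB.
have mZB : measurable (Z @^-1` B) by rewrite -[_ @^-1` _]setTI; exact: mZ.
pose r : {nonneg R} := NngNum (fine_ge0 (measure_ge0 P (Z @^-1` B))).
have rE : (r%:num%:E = P (Z @^-1` B))%E by rewrite /= fineK// fin_num_measure.
have [m mE] := pushforward_measure_exists (mrestr P mZB) (measurable_funPT U).
rewrite -[LHS]/(mrestr P mZB (U @^-1` A)) -mE.
transitivity (mscale r (distribution P U) A); last first.
  by rewrite /mscale/= rE muleC.
apply: finite_measure_eq_on_rays mA => /=.
- by rewrite mE /mrestr ltey_eq fin_num_measure// preimage_setT.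
- move=> u; transitivity ((F u)%:E * P (Z @^-1` B))%E.
    by rewrite mE -(cond_prob_cstE (cU u) mB).
  by rewrite -cond_cdf_cst_ray /mscale/= rE muleC.
Qed.

End independence.

(** * The law of the sample *)

Section product_of_probabilities.
Context d d1 d2 (V : measurableType d) (T1 : measurableType d1)
  (T2 : measurableType d2) (R : realType).
Variables (P : probability (V * (T1 * T2))%type R) (muZ : probability V R)
  (mu1 : probability T1 R) (mu2 : probability T2 R).
Hypothesis Prect : forall C A1 A2,
  measurable C -> measurable A1 -> measurable A2 ->
  P (C `*` (A1 `*` A2)) = (muZ C * (mu1 A1 * mu2 A2))%E.

(** Uniqueness of measures is used twice: rectangles [C] times [D] characterize the outer product,
    and for fixed [C] rectangles [A1] times [A2] characterize the measure in [D]. *)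
Lemma product_law E : measurable E -> (muZ \x (mu1 \x mu2))%E E = P E.
Proof.
move=> mE; pose mu12 : probability (T1 * T2)%type R := (mu1 \x mu2)%E.
apply: (@product_measure_unique _ _ _ _ _ muZ mu12 P) mE => C D mC mD.
have mZC : measurable (fst @^-1` C : set (V * (T1 * T2))%type).
  by rewrite -[X in measurable X]setTI; exact: measurable_fst.
(* [m] sends [D] to the probability of [C] times [D]. *)
have [m msndE] := pushforward_measure_exists (mrestr P mZC) measurable_snd.
have mE' B : P (C `*` B) = m B.
  rewrite msndE /mrestr; congr (P _).
  by apply/seteqP; split => -[z u] [].
pose r : {nonneg R} := NngNum (fine_ge0 (measure_ge0 muZ C)).
have rE : (r%:num%:E = muZ C)%E by rewrite /= fineK// fin_num_measure.
transitivity (m D); first exact: mE'.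
transitivity (mscale r mu12 D); last by rewrite /mscale/= rE.
apply: finite_measure_eq_on_rectangles mD.
- by rewrite -mE' ltey_eq fin_num_measure//; exact: measurableX.
- move=> A1 A2 mA1 mA2; rewrite -mE' Prect// -rE.
  by rewrite -(product_measure1E mu1 mu2).
Qed.

(** The product measure integrates the measures of sections. The section of [E] at [z] is a
    rectangle when [z] lies in [C] and is empty otherwise. *)
Lemma product_law_sections (E : set (V * (T1 * T2))) (C : set V)
    (A1 : V -> set T1) (A2 : V -> set T2) :
  measurable E -> measurable C ->
  (forall z, measurable (A1 z)) -> (forall z, measurable (A2 z)) ->
  (forall z u, E (z, u) <-> [/\ C z, A1 z u.1 & A2 z u.2]) ->
  P E = (\int[muZ]_(z in C) (mu1 (A1 z) * mu2 (A2 z)))%E.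
Proof.
move=> mE mC mA1 mA2 EA; rewrite -product_law// [RHS]integral_mkcond.
apply: eq_integral => z _ /=; rewrite patchE; case: ifPn => [|nCz].
  rewrite inE => Cz; rewrite -(product_measure1E mu1 mu2)//.
  congr (_ _); apply/seteqP; split => u; rewrite /xsection/= inE.
    by move=> /EA [].
  by move=> [? ?]; apply/EA.
rewrite (_ : xsection E z = set0) ?measure0//.
apply/seteqP; split => u //; rewrite /xsection/= inE => /EA[Cz _ _].
by move: nCz; rewrite notin_setE.
Qed.

End product_of_probabilities.

Section product_law.
Context (R : realType) (K : nat).
Local Notation covariates := (K.-tuple R * K.-tuple R)%type.
Local Notation V := (R * covariates)%type.
Local Notation T := (V * (R * R))%type.
Local Notation U1 := (@U1 R K).
Local Notation U2 := (@U2 R K).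
Local Notation Z := (@alphaX R K).

Lemma alphaXE : Z = fst.
Proof. by apply/funext => -[[a x] u]. Qed.

Lemma measurable_alphaX : measurable_fun setT Z.
Proof. by rewrite alphaXE. Qed.

Lemma measurable_U1 : measurable_fun setT U1.
Proof. exact: measurableT_comp measurable_fst measurable_snd. Qed.

Lemma measurable_U2 : measurable_fun setT U2.
Proof. exact: measurableT_comp measurable_snd measurable_snd. Qed.

HB.instance Definition _ :=
  isMeasurableFun.Build _ _ _ _ (@Defs.U1 R K) measurable_U1.
HB.instance Definition _ :=
  isMeasurableFun.Build _ _ _ _ (@Defs.U2 R K) measurable_U2.
HB.instance Definition _ :=
  isMeasurableFun.Build _ _ _ _ (@Defs.alphaX R K) measurable_alphaX.

Variable P : probability T R.
Variables F1 F2 : R -> R.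
Hypothesis cU1 : is_cond_cdf P U1 Z (fun u _ => F1 u).
Hypothesis cU2 : is_cond_cdf P U2 Z (fun u _ => F2 u).
Hypothesis cU12 : cond_independent P U1 U2 Z.

Let mu1 := distribution P U1.
Let mu2 := distribution P U2.
Let muZ := distribution P Z.

(** Each error is independent of [alphaX], so its conditional probabilities have constant versions;
    conditional independence multiplies these constants. *)
Lemma cond_law_rectangle (C : set V) (A1 A2 : set R) :
  measurable C -> measurable A1 -> measurable A2 ->
  P (C `*` (A1 `*` A2)) = (muZ C * (mu1 A1 * mu2 A2))%E.
Proof.
move=> mC mA1 mA2.
have cst_prob (U : {mfun T >-> R}) F A : measurable A ->
    is_cond_cdf P U Z (fun u _ => F u) ->
    is_cond_prob P Z (U @^-1` A) (cst (fine (P (U @^-1` A)))).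
  move=> mA cU; apply: cond_prob_cst => //.
  move=> B mB; rewrite (cond_cdf_cst_indep measurable_alphaX cU)//.
  by rewrite fineK// fin_num_measure//; exact: measurable_funPTI.
have fmu (U : {mfun T >-> R}) A : measurable A ->
    ((fine (P (U @^-1` A)))%:E = distribution P U A)%E.
  by move=> mA; rewrite fineK// fin_num_measure//; exact: measurable_funPTI.
have c12 : is_cond_prob P Z (U1 @^-1` A1 `&` U2 @^-1` A2)
    (cst (fine (P (U1 @^-1` A1)) * fine (P (U2 @^-1` A2)))).
  exact: cU12 mA1 mA2 (cst_prob U1 F1 A1 mA1 cU1) (cst_prob U2 F2 A2 mA2 cU2).
have -> : C `*` (A1 `*` A2) = (U1 @^-1` A1 `&` U2 @^-1` A2) `&` Z @^-1` C.
  apply/seteqP; split => -[[a x] [u1 u2]].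
    by move=> [Cw [? ?]]; split => //; split.
  by move=> [[? ?] Cw]; split => //; split.
have := cond_prob_cstE measurable_alphaX c12 mC.
by rewrite EFinM !fmu// => ->; rewrite muleC.
Qed.

Lemma cond_law_sections (E : set T) (C : set V) (A1 A2 : V -> set R) :
  measurable E -> measurable C ->
  (forall z, measurable (A1 z)) -> (forall z, measurable (A2 z)) ->
  (forall z u, E (z, u) <-> [/\ C z, A1 z u.1 & A2 z u.2]) ->
  P E = (\int[muZ]_(z in C) (mu1 (A1 z) * mu2 (A2 z)))%E.
Proof.
move=> mE mC mA1 mA2; apply: product_law_sections => //.
exact: cond_law_rectangle.
Qed.

End product_law.

(** * Almost sure comparisons from integrals *)

Lemma measurable_set_ltr d (T : measurableType d) (R : realType)
    (f g : T -> R) : measurable_fun setT f -> measurable_fun setT g ->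
  measurable [set x | f x < g x].
Proof.
move=> /measurable_EFinP mf /measurable_EFinP mg.
by rewrite -[X in measurable X]setTI; exact: (measurable_lte measurableT mf mg).
Qed.

Lemma measurable_set_ler d (T : measurableType d) (R : realType)
    (f g : T -> R) : measurable_fun setT f -> measurable_fun setT g ->
  measurable [set x | f x <= g x].
Proof.
move=> /measurable_EFinP mf /measurable_EFinP mg.
by rewrite -[X in measurable X]setTI; exact: (measurable_lee measurableT mf mg).
Qed.

(** On [C] the positive function [f - g] has a nonpositive integral, so it vanishes almost
    everywhere there, which forces [C] to be null. *)
Lemma null_set_of_integral_le d (V : measurableType d) (R : realType)
    (mu : {measure set V -> \bar R}) (C : set V) (f g : V -> R) :
  measurable C ->
  mu.-integrable C (EFin \o f) -> mu.-integrable C (EFin \o g) ->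
  (forall v, C v -> g v < f v) ->
  (\int[mu]_(v in C) (f v)%:E <= \int[mu]_(v in C) (g v)%:E)%E ->
  mu C = 0%E.
Proof.
move=> mC intf intg gf fg.
have intfg : mu.-integrable C (fun v => (f v - g v)%:E).
  exact: (integrableB mC intf intg).
have gf_ge0 v : C v -> (0 <= (f v - g v)%:E)%E.
  by move=> Cv; rewrite lee_fin subr_ge0 ltW// gf.
have : (\int[mu]_(v in C) `|(f v - g v)%:E| = 0)%E.
  under eq_integral => v /[!inE] Cv do rewrite gee0_abs ?gf_ge0//.
  apply/eqP; rewrite eq_le integral_ge0// andbT.
  under eq_integral do rewrite EFinB.
  rewrite integralB_EFin// sube_le0//.
move/(ae_eq_integral_abs mu mC (measurable_int _ intfg)) => [N [mN N0 CN]].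
apply/eqP; rewrite -measure_le0 -N0.
apply: le_measure; rewrite ?inE// => v Cv; apply: CN => /= /(_ Cv) [] /eqP.
by rewrite subr_eq0 gt_eqF// gf.
Qed.

(* If [rho' < rho] on a non-null set, some rational [q] separates them on a
   non-null set, where the two equalities of integrals are incompatible. *)
Lemma density_ratio_null d d' (V : measurableType d) (W : measurableType d')
    (R : realType) (mu mu' : {measure set V -> \bar R}) (p : V -> W)
    (rho rho' : W -> R) (f g f' g' : V -> R) :
  measurable_fun setT p ->
  measurable_fun setT rho -> measurable_fun setT rho' ->
  mu.-integrable setT (EFin \o f) -> mu.-integrable setT (EFin \o g) ->
  mu'.-integrable setT (EFin \o f') -> mu'.-integrable setT (EFin \o g') ->
  (forall v, 0 < g v) -> (forall v, 0 <= g' v) ->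
  (forall v, f v = rho (p v) * g v) -> (forall v, f' v = rho' (p v) * g' v) ->
  (forall B, measurable B -> \int[mu]_(v in p @^-1` B) (f v)%:E =
    \int[mu']_(v in p @^-1` B) (f' v)%:E)%E ->
  (forall B, measurable B -> \int[mu]_(v in p @^-1` B) (g v)%:E =
    \int[mu']_(v in p @^-1` B) (g' v)%:E)%E ->
  mu.-negligible (p @^-1` [set x | rho' x < rho x]).
Proof.
move=> mp mrho mrho' intf intg intf' intg' g0 g'0 fE f'E intff' intgg'.
pose B (q : rat) := [set x | rho' x < ratr q] `&` [set x | ratr q < rho x].
have mB q : measurable (B q).
  by apply: measurableI; exact: measurable_set_ltr.
have mpB q : measurable (p @^-1` B q).
  by rewrite -[X in measurable X]setTI; exact: mp.
have B0 q : mu (p @^-1` B q) = 0%E.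
  have sub (m : {measure set V -> \bar R}) h :
      integrable m setT h -> integrable m (p @^-1` B q) h.
    by move=> ?; apply: (@integrableS _ _ _ _ setT).
  have subZ (m : {measure set V -> \bar R}) (h : V -> R) :
      integrable m setT (EFin \o h) ->
      integrable m (p @^-1` B q) (fun v => (ratr q * h v)%:E).
    by move=> /sub; exact: (integrableZl (mpB q) (ratr q)).
  apply: (@null_set_of_integral_le _ _ _ _ _ f (fun v => ratr q * g v)) => //.
  - exact: sub.
  - exact: subZ.
  - by move=> v [_ qv]; rewrite fE ltr_pM2r.
  (* Both integrals pass to [mu'], where [rho' < q] on [B q] gives [f' <= q g']. *)
  rewrite [leRHS](_ : _ = \int[mu']_(v in p @^-1` B q) (ratr q * g' v)%:E)%E.
    rewrite intff'//; apply: le_integral => //; [exact: sub|exact: subZ|].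
    by move=> v /[!inE] -[qv _]; rewrite lee_fin f'E ler_wpM2r// ltW.
  under eq_integral do rewrite EFinM.
  under [RHS]eq_integral do rewrite EFinM.
  by rewrite !integralZl ?intgg'//; exact: sub.
(* The rationals are enumerated by [unpickle]; an index that decodes to nothing is sent to 0, which
   is harmless since every [B q] has a null preimage. *)
have : mu.-negligible (\bigcup_n (p @^-1` B (odflt 0 (unpickle n)))).
  apply: negligible_bigcup => n.
  by apply/negligibleP; [exact: mpB|exact: B0].
apply: negligibleS => v /= /rat_in_itvoo[q]; rewrite in_itv/= => /andP[? ?].
by exists (pickle q) => //; rewrite pickleK.
Qed.

(** Integrating [M w *m v = 0] entry by entry gives [E(M) v = 0], and [E(M)] is invertible. *)
Lemma expectation_invertible_inj d (T : measurableType d) (R : realType)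
    (P : probability T R) n (M : T -> 'M[R]_n) (v : 'cV[R]_n) :
  expectation_invertible P M -> {ae P, forall w, M w *m v = 0} -> v = 0.
Proof.
move=> [intM uM] Mv0; rewrite -(mulKmx uM v) [X in _ *m X](_ : _ = 0) ?mulmx0//.
apply/colP => i; rewrite !mxE.
have intMv j : P.-integrable setT (fun w => (M w i j * v j 0)%:E).
  apply: (@eq_integrable _ _ _ P _ measurableT
    (fun w => (M w i j)%:E * (v j 0)%:E)%E) => //.
  exact: integrableZr.
transitivity (fine (\sum_j \int[P]_w (M w i j * v j 0)%:E)%E).
  rewrite -sum_fine; last by move=> j _; exact: integrable_fin_num.
  apply: eq_bigr => j _; rewrite mxE unlock.
  under [in RHS]eq_integral do rewrite EFinM.
  rewrite integralZr// fineM//; exact: integrable_fin_num.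
rewrite -integral_sum// (ae_eq_integral (cst 0%E))//=; last 2 first.
- by apply: emeasurable_sum => j; exact: measurable_int (intMv j).
- apply: filterS Mv0 => w /matrixP/(_ i 0) + _; rewrite !mxE => Mv0.
  by rewrite sumEFin Mv0.
by rewrite integral0.
Qed.

(** * Identification of the model *)

Section generalized_inverse.
Variables (R : realType) (Ysupp : set R).

(** The set where [y <= h x] is nonempty because [y] is attained, upward closed by monotonicity, and
    contains its infimum by right continuity: it is a closed right ray. *)
Lemma ginvP (h : R -> R) (y : R) :
  transformation Ysupp h -> Yunder Ysupp y ->
  exists2 c : R, ginv Ysupp h y = c%:E & forall x, (y <= h x) = (c <= x).
Proof.
move=> [rh ndh rch _] [Yy y_inf]; pose S := [set x | y <= h x].
have S0 : S !=set0.
  by move: Yy; rewrite -rh => -[x _ hx]; exists x; rewrite /S/= hx.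
(* Otherwise [y] would be a lower bound of the support that belongs to it, hence its infimum. *)
have [x0 hx0] : exists x0, h x0 < y.
  apply: contrapT => /forallNP noy; case/eqP: y_inf; apply/le_anti/andP; split.
    by apply: le_ereal_inf_tmp => _ [_ /[!(esym rh)] -[x _ <-] <-];
      rewrite lee_fin leNgt; apply/negP/noy.
  by apply: ereal_inf_lbound; exists y.
have lS : has_lbound S.
  exists x0 => x /= yx; rewrite leNgt; apply/negP => /ltW /ndh.
  by move=> /(le_trans yx); rewrite leNgt hx0.
exists (inf S).
  by rewrite /ginv -/S ifF ?ereal_inf_EFin//; apply/negbTE/set0P.
have above x : inf S < x -> y <= h x.
  by move=> /(inf_lt S0)[z yz /ltW /ndh]; exact: le_trans.
have atS : y <= h (inf S).
  apply: (cvgr_to_ge (rch (inf S))); near=> z; apply: above.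
  by near: z; exact: nbhs_right_gt.
move=> x; apply/idP/idP => [|cx]; first exact: (ge_inf lS).
by apply: le_trans atS _; exact: ndh.
Unshelve. all: by end_near. Qed.

(** At level [k x] the common threshold is at most [x], which gives [k x <= k' x]; when [k x] is the
    infimum of the support this is immediate. Exchanging the two functions gives equality. *)
Lemma ginv_inj (h h' : R -> R) :
  transformation Ysupp h -> transformation Ysupp h' ->
  (forall y, Yunder Ysupp y -> ginv Ysupp h y = ginv Ysupp h' y) -> h = h'.
Proof.
have le_h (k k' : R -> R) : transformation Ysupp k ->
    transformation Ysupp k' ->
    (forall y, Yunder Ysupp y -> ginv Ysupp k y = ginv Ysupp k' y) ->
    forall x, k x <= k' x.
  move=> tk tk' kk' x; have Yk : Ysupp (k x) by case: tk => <-; exists x.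
  have [kinf|kinf] := eqVneq (k x)%:E (inf_supp Ysupp).
    rewrite -lee_fin kinf; apply: ereal_inf_lbound; exists (k' x) => //.
    by case: tk' => <-; exists x.
  have Yuk : Yunder Ysupp (k x) by split.
  have [c kc cE] := ginvP tk Yuk; have [c' kc' c'E] := ginvP tk' Yuk.
  move: (kk' _ Yuk); rewrite kc kc' => -[cc'].
  by rewrite c'E -cc' -cE.
move=> th th' hh'; apply/funext => x; apply/le_anti/andP; split.
  exact: le_h.
by apply: le_h => // y Yy; rewrite hh'.
Qed.

End generalized_inverse.

(** * The logistic distribution function *)

Section logistic.
Variable R : realType.
Implicit Types u v : R.

Lemma Lambda_gt0 u : 0 < Lambda u.
Proof. by rewrite divr_gt0 ?addr_gt0 ?expR_gt0. Qed.

Lemma Lambda_lt1 u : Lambda u < 1.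
Proof.
by rewrite ltr_pdivrMr ?addr_gt0 ?expR_gt0// mul1r ltrDr.
Qed.

(** The odds [Lambda u / (1 - Lambda u)] equal [expR u], so a ratio of odds depends only on
    [v - u]. *)
Lemma Lambda_odds u v :
  (1 - Lambda u) * Lambda v = expR (v - u) * (Lambda u * (1 - Lambda v)).
Proof.
rewrite expRB /Lambda; have := expR_gt0 u; have := expR_gt0 v.
move: (expR u) (expR v) => a b b0 a0.
by field; rewrite !gt_eqF ?addr_gt0.
Qed.

Lemma measurable_Lambda : measurable_fun setT (@Lambda R).
Proof.
apply: continuous_measurable_fun => x.
apply: cvgM; first exact: continuous_expR.
apply: cvgV; first by rewrite gt_eqF ?addr_gt0 ?expR_gt0.
by apply: cvgD; [exact: cvg_cst|exact: continuous_expR].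
Qed.

End logistic.

(** * Probabilities of the cells where exactly one outcome reaches its level *)

Section cells.
Context (R : realType) (K : nat).
Local Notation covariates := (K.-tuple R * K.-tuple R)%type.
Local Notation V := (R * covariates)%type.
Variables (s : structure R K) (y1 y2 c1 c2 : R).
Hypothesis h1E : forall x, (y1 <= h1 s x) = (c1 <= x).
Hypothesis h2E : forall x, (y2 <= h2 s x) = (c2 <= x).
Hypothesis ls : logit s.

Let P := law s.
Let mu := distribution P (@alphaX R K).
(** Given [alphaX w = z], the outcome reaches [y1] exactly when [U1 w] is at most this index;
    [index2] plays the same role for [y2]. *)
Definition index1 (z : V) : R := z.1 + (rowX z.2.1 *m beta s) 0 0 - c1.
Definition index2 (z : V) : R := z.1 + (rowX z.2.2 *m beta s) 0 0 - c2.
(** This is [index2 - index1]: [alpha] cancels, leaving a function of the covariates alone. *)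
Definition log_odds (x : covariates) : R :=
  ((rowX x.2 - rowX x.1) *m beta s) 0 0 - (c2 - c1).
(* [p01 z] and [p10 z] are the probabilities of [Y1 < y1, y2 <= Y2] and of
   [y1 <= Y1, Y2 < y2] given [(alpha, X) = z]. *)
Definition p01 (z : V) : R := (1 - Lambda (index1 z)) * Lambda (index2 z).
Definition p10 (z : V) : R := Lambda (index1 z) * (1 - Lambda (index2 z)).

Lemma p01E z : p01 z = expR (log_odds z.2) * p10 z.
Proof.
rewrite /p01 Lambda_odds; congr (expR _ * _).
by rewrite /index1 /index2 /log_odds mulmxBl !mxE; ring.
Qed.

Lemma measurable_rowX_mul d (T : measurableType d) (x : T -> K.-tuple R)
    (b : 'cV[R]_K) : measurable_fun setT x ->
  measurable_fun setT (fun w => (rowX (x w) *m b) 0 0).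
Proof.
move=> mx; under eq_fun do rewrite mxE.
apply: measurable_sum => j; apply: measurable_funM => //.
under eq_fun do rewrite mxE.
exact: measurableT_comp (measurable_tnth j) mx.
Qed.

Lemma measurable_index1 : measurable_fun setT index1.
Proof.
apply: measurable_funB => //; apply: measurable_funD => //.
apply: measurable_rowX_mul.
exact: measurableT_comp measurable_fst measurable_snd.
Qed.

Lemma measurable_index2 : measurable_fun setT index2.
Proof.
apply: measurable_funB => //; apply: measurable_funD => //.
apply: measurable_rowX_mul.
exact: measurableT_comp measurable_snd measurable_snd.
Qed.

Lemma measurable_log_odds : measurable_fun setT log_odds.
Proof.
apply: measurable_funB => //.
under eq_fun do rewrite mulmxBl mxE [X in _ + X]mxE.
by apply: measurable_funB; exact: measurable_rowX_mul.
Qed.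

Lemma measurable_p01 : measurable_fun setT p01.
Proof.
apply: measurable_funM.
  apply: measurable_funB => //.
  exact: measurableT_comp (@measurable_Lambda R) measurable_index1.
exact: measurableT_comp (@measurable_Lambda R) measurable_index2.
Qed.

Lemma measurable_p10 : measurable_fun setT p10.
Proof.
apply: measurable_funM.
  exact: measurableT_comp (@measurable_Lambda R) measurable_index1.
apply: measurable_funB => //.
exact: measurableT_comp (@measurable_Lambda R) measurable_index2.
Qed.

Lemma p01_gt0 z : 0 < p01 z.
Proof. by rewrite mulr_gt0 ?subr_gt0 ?Lambda_lt1 ?Lambda_gt0. Qed.

Lemma p10_gt0 z : 0 < p10 z.
Proof. by rewrite mulr_gt0 ?subr_gt0 ?Lambda_lt1 ?Lambda_gt0. Qed.

Lemma p01_le1 z : p01 z <= 1.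
Proof.
by rewrite mulr_ile1 ?subr_ge0 ?lerBlDr ?lerDl ?ltW ?Lambda_lt1 ?Lambda_gt0.
Qed.

Lemma p10_le1 z : p10 z <= 1.
Proof.
by rewrite mulr_ile1 ?subr_ge0 ?lerBlDr ?lerDl ?ltW ?Lambda_lt1 ?Lambda_gt0.
Qed.

Lemma integrable_p01 : mu.-integrable setT (EFin \o p01).
Proof.
apply: (@le_integrable _ _ _ _ _ measurableT _ (EFin \o cst 1)).
- by apply/measurable_EFinP; exact: measurable_p01.
- by move=> z _; rewrite lee_fin normr1 ger0_norm ?p01_le1// ltW// p01_gt0.
- exact: finite_measure_integrable_cst.
Qed.

Lemma integrable_p10 : mu.-integrable setT (EFin \o p10).
Proof.
apply: (@le_integrable _ _ _ _ _ measurableT _ (EFin \o cst 1)).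
- by apply/measurable_EFinP; exact: measurable_p10.
- by move=> z _; rewrite lee_fin normr1 ger0_norm ?p10_le1// ltW// p10_gt0.
- exact: finite_measure_integrable_cst.
Qed.

(** The thresholds turn the event into [index1 < U1] and [U2 <= index2], a product of rays once
    [alphaX] is fixed. *)
Lemma cell01 (B : set covariates) : measurable B ->
  pushforward P (YX s) [set yx | [/\ yx.1.1 < y1, y2 <= yx.1.2 & B yx.2]] =
  (\int[mu]_(z in snd @^-1` B) (p01 z)%:E)%E.
Proof.
move=> mB; have [cU1 cU2 cU12 _] := ls.
pose E := [set w | [/\ B (alphaX w).2, index1 (alphaX w) < U1 w &
  U2 w <= index2 (alphaX w)]].
have msB : measurable (snd @^-1` B : set V).
  by rewrite -[X in measurable X]setTI; exact: measurable_snd.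
have -> : pushforward P (YX s)
    [set yx | [/\ yx.1.1 < y1, y2 <= yx.1.2 & B yx.2]] = P E.
  congr (P _); apply/seteqP; split => w.
    move=> [/=]; rewrite ltNge h1E h2E -ltNge => l1 l2 Bw; split => //.
      by rewrite /index1 ltrBlDr -ltrBlDl.
    by rewrite /index2 lerBrDr -lerBrDl.
  move=> [/= Bw l1 l2]; split => //=.
    by rewrite ltNge h1E -ltNge /latent1 ltrBlDr -ltrBlDl.
  by rewrite h2E /latent2 lerBrDr -lerBrDl.
rewrite (cond_law_sections cU1 cU2 cU12 (C := snd @^-1` B)
  (A1 := fun z => `]index1 z, +oo[%classic)
  (A2 := fun z => `]-oo, index2 z]%classic)) //.
- apply: eq_integral => z _.
  rewrite (cond_cdf_cst_coray (@measurable_alphaX R K) cU1).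
  by rewrite (cond_cdf_cst_ray (@measurable_alphaX R K) cU2).
- rewrite [X in measurable X](_ : _ = (@alphaX R K @^-1` (snd @^-1` B)) `&`
    ([set w | index1 (alphaX w) < U1 w] `&`
     [set w | U2 w <= index2 (alphaX w)])); last first.
    by apply/seteqP; split => w; [move=> [? ? ?]; split|move=> [? [? ?]]].
  apply: measurableI; first exact: measurable_funPTI.
  apply: measurableI.
    apply: measurable_set_ltr => //.
    exact: measurableT_comp measurable_index1 (@measurable_alphaX R K).
  apply: measurable_set_ler => //.
  exact: measurableT_comp measurable_index2 (@measurable_alphaX R K).
- by move=> [a x] [u1 u2]; rewrite /E/= !in_itv/= andbT.
Qed.

Lemma cell10 (B : set covariates) : measurable B ->
  pushforward P (YX s) [set yx | [/\ y1 <= yx.1.1, yx.1.2 < y2 & B yx.2]] =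
  (\int[mu]_(z in snd @^-1` B) (p10 z)%:E)%E.
Proof.
move=> mB; have [cU1 cU2 cU12 _] := ls.
pose E := [set w | [/\ B (alphaX w).2, U1 w <= index1 (alphaX w) &
  index2 (alphaX w) < U2 w]].
have msB : measurable (snd @^-1` B : set V).
  by rewrite -[X in measurable X]setTI; exact: measurable_snd.
have -> : pushforward P (YX s)
    [set yx | [/\ y1 <= yx.1.1, yx.1.2 < y2 & B yx.2]] = P E.
  congr (P _); apply/seteqP; split => w.
    move=> [/=]; rewrite ltNge h1E h2E -ltNge => l1 l2 Bw; split => //.
      by rewrite /index1 lerBrDr -lerBrDl.
    by rewrite /index2 ltrBlDr -ltrBlDl.
  move=> [/= Bw l1 l2]; split => //=.
    by rewrite h1E /latent1 lerBrDr -lerBrDl.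
  by rewrite ltNge h2E -ltNge /latent2 ltrBlDr -ltrBlDl.
rewrite (cond_law_sections cU1 cU2 cU12 (C := snd @^-1` B)
  (A1 := fun z => `]-oo, index1 z]%classic)
  (A2 := fun z => `]index2 z, +oo[%classic)) //.
- apply: eq_integral => z _.
  rewrite (cond_cdf_cst_coray (@measurable_alphaX R K) cU2).
  by rewrite (cond_cdf_cst_ray (@measurable_alphaX R K) cU1).
- rewrite [X in measurable X](_ : _ = (@alphaX R K @^-1` (snd @^-1` B)) `&`
    ([set w | U1 w <= index1 (alphaX w)] `&`
     [set w | index2 (alphaX w) < U2 w])); last first.
    by apply/seteqP; split => w; [move=> [? ? ?]; split|move=> [? [? ?]]].
  apply: measurableI; first exact: measurable_funPTI.
  apply: measurableI.
    apply: measurable_set_ler => //.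
    exact: measurableT_comp measurable_index1 (@measurable_alphaX R K).
  apply: measurable_set_ltr => //.
  exact: measurableT_comp measurable_index2 (@measurable_alphaX R K).
- by move=> [a x] [u1 u2]; rewrite /E/= !in_itv/= andbT.
Qed.

End cells.

(** * Identification of the parameters and the transformations *)

Section identification.
Context (R : realType) (K : nat) (Ysupp : set R).
Local Notation covariates := (K.-tuple R * K.-tuple R)%type.

(** The cells are events on [(Y, X)], so both structures give them the same probabilities. Their
    densities have ratio [expR] of the log odds, a function of [X], and [density_ratio_null]
    compares the two ratios. *)
Lemma log_odds_ae_eq (s s' : structure R K) (y1 y2 c1 c2 c1' c2' : R) :
  (forall x, (y1 <= h1 s x) = (c1 <= x)) ->
  (forall x, (y2 <= h2 s x) = (c2 <= x)) ->
  (forall x, (y1 <= h1 s' x) = (c1' <= x)) ->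
  (forall x, (y2 <= h2 s' x) = (c2' <= x)) ->
  logit s -> logit s' -> same_observables s s' ->
  {ae law s, forall w, log_odds s c1 c2 (X w) = log_odds s' c1' c2' (X w)}.
Proof.
move=> h1E h2E h1E' h2E' ls ls' obs.
pose mu := distribution (law s) (@alphaX R K).
pose mu' := distribution (law s') (@alphaX R K).
have m1 : measurable_fun setT (fun yx : (R * R) * covariates => yx.1.1).
  exact: measurableT_comp measurable_fst measurable_fst.
have m2 : measurable_fun setT (fun yx : (R * R) * covariates => yx.1.2).
  exact: measurableT_comp measurable_snd measurable_fst.
have msnd (B : set covariates) : measurable B ->
    measurable (snd @^-1` B : set ((R * R) * covariates)).
  by move=> mB; rewrite -[X in measurable X]setTI; exact: measurable_snd.
have e01 B : measurable B ->
    (\int[mu]_(z in snd @^-1` B) (p01 s c1 c2 z)%:E =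
     \int[mu']_(z in snd @^-1` B) (p01 s' c1' c2' z)%:E)%E.
  move=> mB; rewrite -(cell01 h1E h2E ls mB) -(cell01 h1E' h2E' ls' mB).
  apply: obs; rewrite [X in measurable X](_ : _ = [set yx | yx.1.1 < y1] `&`
    ([set yx | y2 <= yx.1.2] `&` snd @^-1` B)).
    apply: measurableI; first exact: measurable_set_ltr.
    by apply: measurableI; [exact: measurable_set_ler|exact: msnd].
  by apply/seteqP; split => w; [move=> [? ? ?]; split|move=> [? [? ?]]].
have e10 B : measurable B ->
    (\int[mu]_(z in snd @^-1` B) (p10 s c1 c2 z)%:E =
     \int[mu']_(z in snd @^-1` B) (p10 s' c1' c2' z)%:E)%E.
  move=> mB; rewrite -(cell10 h1E h2E ls mB) -(cell10 h1E' h2E' ls' mB).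
  apply: obs; rewrite [X in measurable X](_ : _ = [set yx | y1 <= yx.1.1] `&`
    ([set yx | yx.1.2 < y2] `&` snd @^-1` B)).
    apply: measurableI; first exact: measurable_set_ler.
    by apply: measurableI; [exact: measurable_set_ltr|exact: msnd].
  by apply/seteqP; split => w; [move=> [? ? ?]; split|move=> [? [? ?]]].
have mL (t : structure R K) d1 d2 :
    measurable_fun setT (fun x => expR (log_odds t d1 d2 x)).
  exact: measurableT_comp (@measurable_expR R) (measurable_log_odds t d1 d2).
have mLN (t : structure R K) d1 d2 :
    measurable_fun setT (fun x => expR (- log_odds t d1 d2 x)).
  apply: measurableT_comp (@measurable_expR R) _.
  exact: measurableT_comp (measurable_log_odds t d1 d2).
have p10E (t : structure R K) d1 d2 z :
    p10 t d1 d2 z = expR (- log_odds t d1 d2 z.2) * p01 t d1 d2 z.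
  by rewrite p01E mulrA -expRD addNr expR0 mul1r.
have gt_null : mu.-negligible (snd @^-1` [set x |
    expR (log_odds s' c1' c2' x) < expR (log_odds s c1 c2 x)]).
  apply: (density_ratio_null (mu' := mu')
    measurable_snd (mL s c1 c2) (mL s' c1' c2')
    (integrable_p01 s c1 c2) (integrable_p10 s c1 c2)
    (integrable_p01 s' c1' c2') (integrable_p10 s' c1' c2')) => //.
  - exact: p10_gt0.
  - by move=> z; rewrite ltW// p10_gt0.
  - exact: p01E.
  - exact: p01E.
(* Exchanging the cells, rather than the structures, reverses the inequality while keeping the null
   set under [mu]. *)
have lt_null : mu.-negligible (snd @^-1` [set x |
    expR (- log_odds s' c1' c2' x) < expR (- log_odds s c1 c2 x)]).
  apply: (density_ratio_null (mu' := mu')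
    measurable_snd (mLN s c1 c2) (mLN s' c1' c2')
    (integrable_p10 s c1 c2) (integrable_p01 s c1 c2)
    (integrable_p10 s' c1' c2') (integrable_p01 s' c1' c2')) => //.
  - exact: p01_gt0.
  - by move=> z; rewrite ltW// p01_gt0.
have [N [mN N0 subN]] := negligibleU gt_null lt_null.
exists (@alphaX R K @^-1` N); split => //; first exact: measurable_funPTI.
move=> w /= /eqP; rewrite neq_lt => ne; apply: subN => /=.
by rewrite !ltr_expR ltrN2; case/orP: ne; [right|left].
Qed.

(** The log odds are [W theta], the last entry -1 of [W] multiplying [gamma]; equal log odds thus
    put the parameter difference in the kernel of [W]. *)
Lemma log_odds_difference (s s' : structure R K) c1 c2 c1' c2' w :
  (W w *m col_mx (beta s - beta s')
     (const_mx ((c2 - c1) - (c2' - c1')) : 'cV[R]_1)) 0 0 =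
  log_odds s c1 c2 (X w) - log_odds s' c1' c2' (X w).
Proof.
rewrite /W mul_row_col mxE mulmxBr mxE [X in _ + X]mxE big_ord1 !mxE.
by rewrite /log_odds /X1 /X2 !mxE; ring.
Qed.

Lemma thresholds_identified (s s' : structure R K) (y1 y2 c1 c2 c1' c2' : R) :
  (forall x, (y1 <= h1 s x) = (c1 <= x)) ->
  (forall x, (y2 <= h2 s x) = (c2 <= x)) ->
  (forall x, (y1 <= h1 s' x) = (c1' <= x)) ->
  (forall x, (y2 <= h2 s' x) = (c2' <= x)) ->
  logit s -> logit s' -> same_observables s s' ->
  beta s = beta s' /\ c2 - c1 = c2' - c1'.
Proof.
move=> h1E h2E h1E' h2E' ls ls' obs.
have aeq := log_odds_ae_eq h1E h2E h1E' h2E' ls ls' obs.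
have [_ _ _ /expectation_invertible_inj inj] := ls.
have /inj : {ae law s, forall w, ((W w)^T *m W w) *m
    col_mx (beta s - beta s')
      (const_mx ((c2 - c1) - (c2' - c1')) : 'cV[R]_1) = 0}.
  (* Left multiplication by the transpose of [W] leads to the matrix whose expectation is
     invertible. *)
  apply: filterS aeq => w eqw; rewrite -mulmxA [X in _ *m X](_ : _ = 0).
    by rewrite mulmx0.
  by apply/matrixP => i j; rewrite !ord1 log_odds_difference eqw subrr mxE.
move=> /eqP; rewrite col_mx_eq0 => /andP[/eqP/subr0_eq -> /eqP/matrixP/(_ 0 0)].
by rewrite !mxE => /subr0_eq ->.
Qed.

Lemma theta_identified (y1 y2 : R) : Yunder Ysupp y1 -> Yunder Ysupp y2 ->
  identified (@admissible R K Ysupp) (theta Ysupp y1 y2).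
Proof.
move=> Y1 Y2 s s' [t1 t2 _ _ ls] [t1' t2' _ _ ls'] obs.
have [c1 g1 h1E] := ginvP t1 Y1; have [c2 g2 h2E] := ginvP t2 Y2.
have [c1' g1' h1E'] := ginvP t1' Y1; have [c2' g2' h2E'] := ginvP t2' Y2.
have [eqb eqc] := thresholds_identified h1E h2E h1E' h2E' ls ls' obs.
by rewrite /theta /gamma g1 g2 g1' g2' eqb -!EFinB eqc.
Qed.

End identification.

Theorem theorem3 (R : realType) (K : nat) (Ysupp : set R) :
  (forall y1 y2 : R, Yunder Ysupp y1 -> Yunder Ysupp y2 ->
     identified (@admissible R K Ysupp) (theta Ysupp y1 y2)) /\
  (forall y0 : R, Yunder Ysupp y0 ->
     identified (@admissible R K Ysupp `&` normalized Ysupp y0)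
       (fun s => (h1 s, h2 s))).
Proof.
split=> [y1 y2|y0 Y0 s s' [As n0] [As' n0'] obs]; first exact: theta_identified.
have [t1 t2 _ _ _] := As; have [t1' t2' _ _ _] := As'.
have eq_gamma y1 y2 : Yunder Ysupp y1 -> Yunder Ysupp y2 ->
    gamma Ysupp y1 y2 s = gamma Ysupp y1 y2 s'.
  by move=> Y1 Y2; case: (theta_identified Y1 Y2 As As' obs).
(* Since [h_1^-(y0) = 0], [gamma] at [(y0, y)] is [h_2^-(y)] itself. *)
have eq2 y : Yunder Ysupp y -> ginv Ysupp (h2 s) y = ginv Ysupp (h2 s') y.
  by move=> Y; have := eq_gamma _ _ Y0 Y; rewrite /gamma n0 n0' !sube0.
(* In [gamma] at [(y, y0)] the term [h_2^-(y0)] is now common to both structures; finiteness of the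
   thresholds allows its cancellation. *)
have eq1 y : Yunder Ysupp y -> ginv Ysupp (h1 s) y = ginv Ysupp (h1 s') y.
  move=> Y; have := eq_gamma _ _ Y Y0; rewrite /gamma (eq2 _ Y0).
  have [c -> _] := ginvP t1 Y; have [c' -> _] := ginvP t1' Y.
  have [c0 -> _] := ginvP t2' Y0.
  by rewrite -!EFinB => -[/addrI/oppr_inj ->].
by rewrite (ginv_inj t1 t1' eq1) (ginv_inj t2 t2' eq2).
Qed.
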